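(* Let $S$ be the set of all vectors in $\mathbb{R}^d$ with at most $10$ non-zero coordinates, all of whose non-zero coordinates are equal to $1$. Let $A \in \mathbb{R}^{m\times d}$ be a matrix such that $\frac{1}{2} \|x\|_{\infty} \le \|Ax\|_{\infty} \le \frac{3}{2} \|x\|_{\infty}$ for all $x \in S$. Then $m = \Omega(d)$, i.e., $m \ge c\,d$ for an absolute constant $c>0$. *)

(* Defs.v *)
From HB Require Import structures.
From mathcomp Require Import all_boot all_order all_algebra.
From mathcomp Require Import all_classical all_reals all_analysis.
Set Implicit Arguments.
Unset Strict Implicit.
Unset Printing Implicit Defensive.
Import Order.TTheory GRing.Theory Num.Theory.
Import numFieldNormedType.Exports.
Local Open Scope classical_set_scope.
Local Open Scope ring_scope.

(* The library norm `|x| on 'cV[R]_n is the max norm (mx_norm), i.e. the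
   l_infinity norm; it is 0 when n = 0. *)
Definition sparse_binary (R : realType) (k d : nat) : set 'cV[R]_d :=
  [set x : 'cV[R]_d | (#|[pred i : 'I_d | (x i 0 != 0)%R]| <= k)%N /\
     forall i : 'I_d, x i 0 != 0 -> x i 0 = 1].
Arguments sparse_binary : clear implicits.

(* Main.v *)
Require Import Defs.
From HB Require Import structures.
From mathcomp Require Import all_boot all_order all_algebra.
From mathcomp Require Import all_classical all_reals all_analysis.
From mathcomp Require Import lra.
Set Implicit Arguments.
Unset Strict Implicit.
Unset Printing Implicit Defensive.
Import Order.TTheory GRing.Theory Num.Theory.
Import numFieldNormedType.Exports.
Local Open Scope classical_set_scope.
Local Open Scope ring_scope.

(* Testing on unit vectors, every column of A has an entry of absolute value at
   least 1/2.  Testing on indicators of 4-element sets, no row has 4 entries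
   [>= 1/2], nor 4 entries [<= -1/2], since these would sum to at least 2 > 3/2
   in absolute value.  So the m rows serve at most 6 columns each and d <= 6m. *)

Definition indicator_cv (R : realType) (d : nat) (B : {set 'I_d}) : 'cV[R]_d :=
  \col_j (j \in B)%:R.
Arguments indicator_cv : clear implicits.

Lemma sparse_binary_indicator (R : realType) (k d : nat) (B : {set 'I_d}) :
  (#|B| <= k)%N -> sparse_binary R k d (indicator_cv R d B).
Proof.
move=> Bk; split; last by move=> i; rewrite mxE; case: (i \in B); rewrite ?eqxx.
apply: leq_trans Bk; apply: eq_leq; apply: eq_card => i.
by rewrite inE mxE pnatr_eq0 eqb0 negbK.
Qed.

Lemma mulmx_indicator (R : realType) (m d : nat) (A : 'M[R]_(m, d))
    (B : {set 'I_d}) (i : 'I_m) :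
  (A *m indicator_cv R d B) i 0 = \sum_(j in B) A i j.
Proof.
rewrite mxE [RHS]big_mkcond /=; apply: eq_bigr => j _.
by rewrite mxE; case: (j \in B); rewrite ?mulr1 ?mulr0.
Qed.

Lemma ler_entry_norm (R : realType) (m n : nat) (x : 'M[R]_(m, n)) i j :
  `|x i j| <= `|x|.
Proof.
rewrite [leRHS]mx_normrE; exact: (le_bigmax _ (fun ij => `|x ij.1 ij.2|) (i, j)).
Qed.

Lemma norm_mx_le (R : realType) (m n : nat) (x : 'M[R]_(m, n)) (b : R) :
  0 <= b -> (forall i j, `|x i j| <= b) -> `|x| <= b.
Proof.
by move=> b0 xb; rewrite [leLHS]mx_normrE; apply: bigmax_le => // -[i j] _ /=.
Qed.

(** The norm is a maximum over the entries with default value 0, so a positive lower bound rules out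
    the default (the case of an empty matrix) and must be met by an actual entry. *)
Lemma exists_entry_ge (R : realType) (m n : nat) (x : 'M[R]_(m, n)) (b : R) :
  0 < b -> b <= `|x| -> exists ij : 'I_m * 'I_n, b <= `|x ij.1 ij.2|.
Proof.
move=> b0 bx; apply: contrapT => /forallNP small; move: bx; apply/negP.
rewrite -ltNge [ltLHS]mx_normrE; apply: bigmax_lt => // ij _.
by rewrite ltNge; apply/negP/small.
Qed.

Lemma norm_indicator_le1 (R : realType) (d : nat) (B : {set 'I_d}) :
  `|indicator_cv R d B| <= 1.
Proof.
by apply: norm_mx_le => // i j; rewrite mxE; case: (i \in B);
  rewrite ?normr1 ?normr0.
Qed.

Lemma norm_indicator1 (R : realType) (d : nat) (j : 'I_d) :
  `|indicator_cv R d [set j]%SET| = 1.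
Proof.
apply/eqP; rewrite eq_le norm_indicator_le1 /=.
by have := ler_entry_norm (indicator_cv R d [set j]%SET) j 0;
  rewrite mxE set11 normr1.
Qed.

Lemma column_entry_ge_half (R : realType) (k m d : nat) (A : 'M[R]_(m, d)) :
  (0 < k)%N ->
  (forall x, sparse_binary R k d x -> 1 / 2 * `|x| <= `|A *m x|) ->
  forall j, exists i, 1 / 2 <= `|A i j|.
Proof.
move=> k0 lb j.
have /lb : sparse_binary R k d (indicator_cv R d [set j]%SET).
  by apply: sparse_binary_indicator; rewrite cards1.
(* The image of a unit vector is the column [j] of [A], so the entry found lies in that column. *)
rewrite norm_indicator1 mulr1 => /exists_entry_ge[|[i z] /=]; first by lra.
by rewrite ord1 mulmx_indicator big_set1 => Aij; exists i.
Qed.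

(* The sign [s] is [1] or [-1], to treat both kinds of large entries at once. *)
Lemma card_row_ge_half (R : realType) (k m d : nat) (A : 'M[R]_(m, d)) (s : R) :
  (4 <= k)%N -> `|s| = 1 ->
  (forall x, sparse_binary R k d x -> `|A *m x| <= 3 / 2 * `|x|) ->
  forall i, (#|[pred j | (1 / 2 <= s * A i j)%R]| <= 3)%N.
Proof.
(* Exactly four of the large entries are kept, so that the test vector is [k]-sparse however many
   there are. *)
move=> k4 s1 ub i; rewrite leqNgt; apply/negP => /card_geqP[r [Ur r4 rsub]].
pose B := [set j in r]%SET.
have B4 : #|B| = 4%N by rewrite cardsE (card_uniqP Ur).
have /ub : sparse_binary R k d (indicator_cv R d B).
  by apply: sparse_binary_indicator; rewrite B4.
have := norm_indicator_le1 R B.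
have := ler_entry_norm (A *m indicator_cv R d B) i 0.
have : 2 <= `|(A *m indicator_cv R d B) i 0|.
  (* As [|s| = 1], the sign can be moved inside the absolute value, where it makes all four summands
     at least 1/2. *)
  rewrite mulmx_indicator -[leRHS]mul1r -[X in X * `|_|]s1 -normrM mulr_sumr.
  apply: le_trans (ler_norm _).
  have -> : 2 = \sum_(j in B) (1 / 2 : R) by rewrite sumr_const B4 -mulr_natr; lra.
  by apply: ler_sum => j; rewrite inE => /rsub.
(* The chain 2 <= [|(A *m 1_B) i 0|] <= [|A *m 1_B|] <= 3/2 * [|1_B|] <= 3/2 is contradictory. *)
by lra.
Qed.

Theorem mainTheorem9 (R : realType) :
  exists c : R, 0 < c /\
    forall (m d : nat) (A : 'M[R]_(m, d)),
      (forall x : 'cV[R]_d, sparse_binary R 10 d x ->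
         1 / 2 * `|x| <= `|A *m x| /\ `|A *m x| <= 3 / 2 * `|x|) ->
      c * d%:R <= m%:R.
Proof.
exists (1 / 6); split=> [|m d A hA]; first by lra.
have col := @column_entry_ge_half R 10 m d A isT (fun x Sx => (hA x Sx).1).
have row s s1 :=
  @card_row_ge_half R 10 m d A s isT s1 (fun x Sx => (hA x Sx).2).
pose big s i j : bool := 1 / 2 <= s * A i j.
have dm : (d <= m * 6)%N.
  have sum1_ord n : (\sum_(i < n) 1 = n)%N by rewrite sum1_card card_ord.
  rewrite -[leqLHS]sum1_ord -[X in (X * 6)%N]sum1_ord big_distrl /=.
  (* Double counting of the large entries, split by sign: each column contributes at least 1, each
     row at most 6. *)
  apply: (@leq_trans (\sum_(j < d) \sum_(i < m) (big 1%R i j + big (-1)%R i j))%N).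
    apply: leq_sum => j _; have [i] := col j.
    (* The row [i] alone contributes 1 through one of the two signs; the other rows are dropped. *)
    rewrite (bigD1 i) //= /big (mul1r (A i j)) mulN1r => Aij.
    apply: leq_trans (leq_addr _ _).
    by move: Aij; rewrite ler_normr => /orP[] ->; rewrite ?addn1.
  rewrite exchange_big /=.
  (* At most 3 large entries of each sign per row. *)
  apply: leq_sum => i _; rewrite big_split mul1n -[6%N]/(3 + 3)%N.
  by apply: leq_add; rewrite -big_mkcond sum1_card row ?normrN ?normr1.
by move: dm; rewrite -(ler_nat R) natrM; lra.
Qed.
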